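(* Let $s\geq 4$ be an even integer. For all integers $n,k\geq 1$, \[ C_{s}(n,k)=\sum_{\ell\in N(s)} C_{s}^{\ell}(n,k)+C_{s}^{s+1}(n,k), \] and moreover, for every $\ell\in N(s)$, \[ C_{s}^{\ell}(n,k)=C_{s}(n-\ell,k-1)-\sum_{i\in N'(\ell)}C_{s}^{i}(n-\ell,k-1) \quad\text{and}\quad C_{s}^{s+1}(n,k)=C_{s}(n-sk,k). \]
   Context: A partition is $s$-congruent if none of its parts is congruent to $2,4,\dots,s-2$ modulo $s$. $C_s(n,k)$ is the number of $s$-congruent partitions of $n$ into exactly $k$ parts. $N(s)=\{1,3,5,\dots,s-1\}\cup\{s\}$, and for $\ell\in N(s)$, $N'(\ell)$ is the set of odd positive integers less than $\ell$. For $\ell\in N(s)$, $C_s^{\ell}(n,k)$ is the number of $s$-congruent partitions of $n$ into $k$ parts whose smallest part equals $\ell$; $C_s^{s+1}(n,k)$ is the number of $s$-congruent partitions of $n$ into $k$ parts all of which are greater than $s$. Conventions: $C_s(0,0)=1$, $C_s(m,0)=0$ for $m\neq 0$, and all these counts are $0$ when the first argument is negative. *)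

(* Defs.v *)
From mathcomp Require Export all_boot all_order all_algebra.

Set Implicit Arguments.
Unset Strict Implicit.
Unset Printing Implicit Defensive.

Definition is_partition (n : nat) (p : seq nat) : bool :=
  [&& sorted geq p, all (leq 1) p & sumn p == n].

(* The index range is 2 <= j <= s - 2. *)
Definition s_congruent (s : nat) (p : seq nat) : bool :=
  all (fun x => all (fun j => x != j %[mod s])
                    [seq j <- index_iota 2 s.-1 | ~~ odd j]) p.

Definition smallest_part (l : nat) (p : seq nat) : bool :=
  (l \in p) && all (leq l) p.

(* The parts of a partition of n are at most n, so that 'I_n.+1 is large enough
   to hold them. *)
Definition count_partitions (P : pred (seq nat)) (n : int) (k : nat) : nat :=
  match n with
  | Posz m => #|[set t : k.-tuple 'I_m.+1 |
                  is_partition m (map val t) && P (map val t)]|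
  | Negz _ => 0
  end.

Definition C (s : nat) (n : int) (k : nat) : nat :=
  count_partitions (s_congruent s) n k.

Definition C_min (s l : nat) (n : int) (k : nat) : nat :=
  count_partitions (fun p => s_congruent s p && smallest_part l p) n k.

(* This is $C_s^{s+1}$, which counts the partitions with all parts greater than
   s: it is not the case l = s + 1 of C_min. *)
Definition C_gt (s : nat) (n : int) (k : nat) : nat :=
  count_partitions (fun p => s_congruent s p && all (ltn s) p) n k.

Definition N (s : nat) : seq nat := rcons [seq l <- index_iota 1 s | odd l] s.

Definition N' (l : nat) : seq nat := [seq i <- index_iota 1 l | odd i].

(* Main.v *)
Require Import Defs.
From mathcomp Require Import zify.

Set Implicit Arguments.
Unset Strict Implicit.
Unset Printing Implicit Defensive.

Import GRing.Theory.

(** Partitions are decreasing sequences, so the smallest part is the last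
    element.  An [s]-congruent partition whose smallest part is at most [s] has
    its smallest part in [N s], since the only even residue allowed modulo [s]
    is [0].  Deleting one smallest part [l] leaves an arbitrary [s]-congruent
    partition of [n - l] without parts below [l], i.e. with no smallest part in
    [N' l]; subtracting [s] from each part leaves all residues unchanged. *)

Lemma all_leq_sumn (p : seq nat) : all (fun x => x <= sumn p) p.
Proof.
elim: p => //= x p IHp; rewrite leq_addr /=.
by apply: sub_all IHp => y; lia.
Qed.

(** Having [g] as a left inverse makes [f] injective on the partitions counted on the left. Used in
    both directions, this turns a bijection between partitions, given on plain sequences, into an
    equality of counts. *)
Lemma leq_count_partitions (P Q : pred (seq nat)) (m m' k k' : nat)
    (f g : seq nat -> seq nat) :
  (forall p, size p = k -> is_partition m p -> P p ->
     [/\ size (f p) = k', is_partition m' (f p), Q (f p) & g (f p) = p]) ->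
  count_partitions P m k <= count_partitions Q m' k'.
Proof.
move=> fP /=; set A := [set t | _]; set B := [set t | _].
(* [F] is [f] carried over to tuples. On [A], [inord] alters no value, since each part of a
   partition of [m'] is at most [m']. *)
pose F (t : k.-tuple 'I_m.+1) : k'.-tuple 'I_m'.+1 :=
  [tuple inord (nth 0 (f (map val t)) i) | i < k'].
have valF t : t \in A -> map val (F t) = f (map val t).
  rewrite inE => /andP[tp Pt].
  have [szf /and3P[_ _ /eqP sumf] _ _] := fP _ (etrans (size_map _ _) (size_tuple t)) tp Pt.
  apply: (@eq_from_nth _ 0) => [|i]; rewrite size_map size_tuple ?szf // => ltik.
  rewrite (nth_map ord0) ?size_tuple // (nth_mktuple _ _ (Ordinal ltik)) /= inordK //.
  rewrite ltnS -sumf; apply: (allP (all_leq_sumn _)).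
  by rewrite mem_nth // szf.
have gF t : t \in A -> g (f (map val t)) = map val t.
  rewrite inE => /andP[tp Pt].
  by case: (fP _ (etrans (size_map _ _) (size_tuple t)) tp Pt).
have injF : {in A &, injective F}.
  move=> t u tA uA eqF; apply/val_inj/(inj_map val_inj).
  by rewrite -gF // -[RHS]gF // -!valF // eqF.
rewrite -(card_in_imset injF); apply/subset_leq_card/subsetP=> _ /imsetP[t tA ->].
move: (tA); rewrite !inE valF // => /andP[tp Pt].
by case: (fP _ (etrans (size_map _ _) (size_tuple t)) tp Pt) => _ -> ->.
Qed.

Lemma eq_count_partitions (P Q : pred (seq nat)) (n : int) (k : nat) :
  (forall p, size p = k -> sorted geq p -> all (leq 1) p -> P p = Q p) ->
  count_partitions P n k = count_partitions Q n k.
Proof.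
case: n => [m|//] eqPQ; apply/eqP; rewrite eqn_leq.
by apply/andP; split; apply: (leq_count_partitions (f := id) (g := id)) => p szp pp Pp;
  split=> //; move: (pp) Pp => /and3P[? ? _]; rewrite eqPQ.
Qed.

Lemma count_partitions_eq0 (P : pred (seq nat)) (n : int) (k : nat) :
  (forall m p, n = Posz m -> size p = k -> is_partition m p -> ~~ P p) ->
  count_partitions P n k = 0.
Proof.
case: n => [m|//] nP; apply: eq_card0 => t; rewrite inE; apply/negP => /andP[tp].
by apply/negP/(nP m) => //; rewrite size_map size_tuple.
Qed.

Lemma count_partitions_split (Q P : pred (seq nat)) (n : int) (k : nat) :
  count_partitions P n k =
    count_partitions (predI P Q) n k + count_partitions (predD P Q) n k.
Proof.
case: n => [m|//] /=.
rewrite -(cardsID [set t : k.-tuple 'I_m.+1 | Q (map val t)]).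
by congr (_ + _); apply: eq_card => t; rewrite !inE /=;
  case: (is_partition _ _); case: (P _); case: (Q _).
Qed.

Lemma smallest_part_uniq (p : seq nat) (l l' : nat) :
  smallest_part l p -> smallest_part l' p -> l = l'.
Proof.
move=> /andP[lp /allP le_l] /andP[l'p /allP le_l'].
by apply/eqP; rewrite eqn_leq le_l // le_l'.
Qed.

Lemma smallest_part_rcons (q : seq nat) (x l : nat) :
  sorted geq (rcons q x) -> smallest_part l (rcons q x) = (l == x).
Proof.
rewrite sorted_pairwise; last by move=> a b c /=; lia.
rewrite pairwise_rcons => /andP[le_x _].
have sx : smallest_part x (rcons q x).
  by rewrite /smallest_part mem_rcons mem_head all_rcons leqnn.
by apply/idP/eqP=> [/smallest_part_uniq/(_ sx)|->].
Qed.

(** A partition has at most one smallest part, so distinct elements of [L] select disjoint classes.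
    The last term collects what no element of [L] selects, including the empty partition. *)
Lemma count_partitions_smallest (P : pred (seq nat)) (n : int) (k : nat) (L : seq nat) :
  uniq L ->
  count_partitions P n k =
    \sum_(l <- L) count_partitions (fun p => P p && smallest_part l p) n k
    + count_partitions (fun p => P p && ~~ has (smallest_part^~ p) L) n k.
Proof.
elim: L => [_|a L IHL /= /andP[aL uL]].
  by rewrite big_nil add0n; apply: eq_count_partitions => p _ _ _ /=; rewrite andbT.
rewrite big_cons {1}(IHL uL) (count_partitions_split (smallest_part a) (fun p => _ && ~~ _)).
rewrite addnCA -addnA; congr (_ + (_ + _)); apply: eq_count_partitions => p _ _ _ /=.
- case: (P p) => //=; case: hasP => //= -[l lL sl].
  by apply/esym/negP => /smallest_part_uniq/(_ sl) eql; rewrite eql lL in aL.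
- by rewrite negb_or andbCA.
Qed.

(** As [s] is even, reduction modulo [s] preserves parity, and the excluded residues are exactly the
    nonzero even ones. *)
Lemma s_congruentE (s : nat) (p : seq nat) : ~~ odd s -> 0 < s ->
  s_congruent s p = all (fun x => odd x || (s %| x)) p.
Proof.
move=> es s0; have odd_mods x : odd (x %% s) = odd x.
  by rewrite {2}(divn_eq x s) oddD oddM (negPf es) andbF.
apply: eq_all => x; apply/allP/idP => [xP|xP j].
  apply: contraT; rewrite negb_or => /andP[ex nsx].
  have /xP : x %% s \in [seq j <- index_iota 2 s.-1 | ~~ odd j].
    have := ltn_pmod x s0; move: nsx (odd_mods x); rewrite /dvdn.
    by rewrite mem_filter mem_index_iota; lia.
  by rewrite modn_mod eqxx.
rewrite mem_filter mem_index_iota => /andP[ej /andP[j2 js]].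
rewrite [X in _ != X]modn_small; last by lia.
apply: contraNneq ej => xj; case/orP: xP => [|/eqP xs]; last by lia.
by rewrite -odd_mods xj.
Qed.

Lemma mem_N' (l i : nat) : (i \in N' l) = odd i && (i < l).
Proof. by rewrite mem_filter mem_index_iota; lia. Qed.

Lemma mem_N (s l : nat) : (l \in N s) = (odd l && (l < s)) || (l == s).
Proof. by rewrite mem_rcons inE -[_ \in filter _ _]/(l \in N' s) mem_N' orbC. Qed.

Lemma uniq_N' (l : nat) : uniq (N' l).
Proof. exact/filter_uniq/iota_uniq. Qed.

Lemma uniq_N (s : nat) : uniq (N s).
Proof. by rewrite rcons_uniq -[filter _ _]/(N' s) uniq_N' mem_N' ltnn andbF. Qed.

Section Recurrences.

Variable s : nat.
Hypotheses (s_even : ~~ odd s) (s_gt0 : 0 < s).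

(** The hypothesis says that, among the admissible parts, [L] contains exactly those below [l]. The
    last part then decides both sides; for the empty partition both are true. *)
Lemma not_has_smallest_part (L : seq nat) (l : nat) (p : seq nat) :
  (forall x, 0 < x -> odd x || (s %| x) -> (x \in L) = (x < l)) ->
  sorted geq p -> all (leq 1) p -> s_congruent s p ->
  ~~ has (smallest_part^~ p) L = all (leq l) p.
Proof.
move=> LP; rewrite s_congruentE //; case/lastP: p => [|q x] sp.
  by move=> _ _ /=; rewrite has_pred0.
rewrite !all_rcons => /andP[x0 _] /andP[sx _].
rewrite (eq_has (a2 := pred1 x) (fun i => smallest_part_rcons i sp)) has_pred1 LP // -leqNgt.
move: sp; rewrite sorted_pairwise; last by move=> a b c /=; lia.
rewrite pairwise_rcons => /andP[/allP le_x _].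
apply/esym/andb_idr => lx; apply/allP => y /le_x /=; lia.
Qed.

(** Common source of the first two identities of the theorem: [L] is [N s] with bound [s.+1] in one,
    [N' l] with bound [l] in the other. *)
Lemma C_sum_smallest (L : seq nat) (l : nat) (n : int) (k : nat) : uniq L ->
  (forall x, 0 < x -> odd x || (s %| x) -> (x \in L) = (x < l)) ->
  C s n k = \sum_(i <- L) C_min s i n k
            + count_partitions (fun p => s_congruent s p && all (leq l) p) n k.
Proof.
move=> uL LP; rewrite /C (count_partitions_smallest _ _ _ uL); congr (_ + _).
apply: eq_count_partitions => p _ sp p1; apply: andb_id2l => cp.
exact: not_has_smallest_part.
Qed.

Lemma C_min_delete (l n k : nat) : l \in N s ->
  C_min s l n k.+1 =
    count_partitions (fun p => s_congruent s p && all (leq l) p) (n%:Z - l%:Z)%R k.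
Proof.
rewrite mem_N => lN; have l0 : 0 < l by lia.
(* If [n < l], the left side vanishes because no part exceeds the sum, and the right side because
   its argument is negative. *)
have [ltnl|leln] := ltnP n l.
  rewrite /C_min count_partitions_eq0 => [|m p [<-] _ /and3P[_ _ /eqP sump]].
    by rewrite count_partitions_eq0 // => m p; lia.
  rewrite negb_and; apply/orP; right; apply/negP => /andP[lp _].
  by have := allP (all_leq_sumn p) _ lp; lia.
have {leln} [m ->] : exists m, n = m + l by exists (n - l); lia.
rewrite (_ : (_ - _)%R = Posz m); last by lia.
have trg : transitive geq by move=> a b c /=; lia.
have cl : odd l || (s %| l) by case/orP: lN => [/andP[-> //]|/eqP ->]; rewrite dvdnn orbT.
apply/eqP; rewrite eqn_leq; apply/andP; split.
(* Among [k.+1] decreasing parts, [take k] drops exactly the last one, which is [l]. *)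
- apply: (leq_count_partitions (f := take k) (g := rcons^~ l)) => p.
  case/lastP: p => // q x; rewrite size_rcons => -[szq] /and3P[sp p1 sump].
  move=> /andP[]; rewrite smallest_part_rcons // => + /eqP lx.
  rewrite -cats1 take_cat szq ltnn subnn take0 cats0 cats1.
  move: p1 sump sp; rewrite -{x}lx !s_congruentE // sorted_pairwise // pairwise_rcons.
  rewrite !all_rcons sumn_rcons eqn_add2r => /andP[_ q1] sumq /andP[leq sq] /andP[_ cq].
  by split; rewrite ?cq //; apply/and3P; rewrite sorted_pairwise.
- apply: (leq_count_partitions (f := rcons^~ l) (g := take k)) => q szq.
  case/and3P=> sq q1 sumq /andP[cq leq].
  have sp : sorted geq (rcons q l).
    by rewrite sorted_pairwise // pairwise_rcons leq -sorted_pairwise.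
  split; first by rewrite size_rcons szq.
  + by rewrite /is_partition sp all_rcons l0 q1 sumn_rcons eqn_add2r sumq.
  + by move: cq; rewrite smallest_part_rcons // eqxx !s_congruentE // all_rcons cl => ->.
  + by rewrite -cats1 take_cat szq ltnn subnn take0 cats0.
Qed.

Lemma sumn_map_addn (p : seq nat) : sumn (map (addn s) p) = s * size p + sumn p.
Proof. by elim: p => [|x p /= ->] /=; lia. Qed.

Lemma C_gt_shift (n k : nat) : C_gt s n k = C s (n%:Z - (s * k)%N%:Z)%R k.
Proof.
(* Truncated subtraction is undone here because every part exceeds [s]. *)
have shiftK p : all (ltn s) p -> map (addn s) (map (subn^~ s) p) = p.
  move=> sp; rewrite -map_comp -[RHS]map_id; apply/eq_in_map => x /(allP sp) /=; lia.
have sorted_shift p : sorted geq (map (addn s) p) = sorted geq p.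
  rewrite sorted_map; apply: eq_sorted => x y /=; lia.
have gt_shift p : all (ltn s) (map (addn s) p) = all (leq 1) p.
  by rewrite all_map; apply: eq_all => x /=; lia.
have cong_shift p : s_congruent s (map (addn s) p) = s_congruent s p.
  rewrite !s_congruentE // all_map; apply: eq_all => x /=.
  by rewrite oddD (negPf s_even) dvdn_addr.
(* If [n < s * k], then [k] parts greater than [s] cannot sum to [n], and the right side has a
   negative argument. *)
have [lt_n|le_n] := ltnP n (s * k).
  rewrite /C [RHS]count_partitions_eq0; last by move=> m p; lia.
  apply: count_partitions_eq0 => m p [<-] szp /and3P[_ _ /eqP sump].
  rewrite negb_and; apply/orP; right; apply/negP => /shiftK eqp.
  by move: sump; rewrite -eqp sumn_map_addn size_map szp; lia.
have {le_n} [m ->] : exists m, n = s * k + m by exists (n - s * k); lia.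
rewrite (_ : (_ - _)%R = Posz m); last by lia.
apply/eqP; rewrite eqn_leq; apply/andP; split.
- apply: (leq_count_partitions (f := map (subn^~ s)) (g := map (addn s))) => p.
  move=> szp /and3P[+ _ +] /andP[+ gtp]; rewrite -[in sorted _ p](shiftK p) //.
  rewrite -[in sumn p](shiftK p) // -[in s_congruent s p](shiftK p) //.
  rewrite sorted_shift sumn_map_addn cong_shift size_map szp eqn_add2l => sp sump cp.
  by split; rewrite ?size_map ?shiftK // /is_partition sp sump -gt_shift shiftK ?gtp.
- apply: (leq_count_partitions (f := map (addn s)) (g := map (subn^~ s))) => p.
  move=> szp /and3P[sp p1 sump] cp; split; rewrite ?size_map //.
  + rewrite /is_partition sorted_shift sp sumn_map_addn szp eqn_add2l sump andbT.
    by rewrite all_map; apply: sub_all p1 => x /=; lia.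
  + by rewrite cong_shift cp gt_shift.
  + by rewrite -map_comp -[RHS]map_id; apply: eq_map => x /=; lia.
Qed.

End Recurrences.

Local Open Scope ring_scope.

Theorem theorem7 (s : nat) (hs4 : (4 <= s)%N) (hs : ~~ odd s)
    (n k : nat) (hn : (1 <= n)%N) (hk : (1 <= k)%N) :
  [/\ C s n k = (\sum_(l <- N s) C_min s l n k + C_gt s n k)%N,
      forall l : nat, l \in N s ->
        (C_min s l n k)%:Z
        = (C s (n%:Z - l%:Z) (k - 1)%N)%:Z
          - \sum_(i <- N' l) (C_min s i (n%:Z - l%:Z) (k - 1)%N)%:Z
    & C_gt s n k = C s (n%:Z - (s * k)%N%:Z) k].
Proof.
have s0 : (0 < s)%N by lia.
split; last exact: C_gt_shift.
(* The remainder term is [C_gt], as [ltn s] unfolds to [leq s.+1]. The only positive multiple of [s]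
   up to [s] is [s] itself. *)
- apply: (C_sum_smallest hs s0 (l := s.+1) n k (uniq_N s)) => x x0 cx; rewrite mem_N.
  case/orP: cx => [ox|/(dvdn_leq x0)]; last by lia.
  have : x != s by apply: contraTneq ox => ->.
  by lia.
- case: k hk => // k _ l lN; rewrite subSS subn0 C_min_delete //.
  (* Expanding [C] at [n - l] by smallest part, the sum over [N' l] cancels the subtracted one and
     leaves the count of partitions without parts below [l]. *)
  rewrite (@C_sum_smallest s hs s0 (N' l) l) ?uniq_N' // => [|x x0 cx].
    by rewrite PoszD (big_morph Posz PoszD (erefl 0%:Z)) addrAC subrr add0r.
  (* Since [l <= s], no positive multiple of [s] lies below [l], so only odd parts do. *)
  rewrite mem_N'; move: lN; rewrite mem_N => lN.
  by case/orP: cx => [->//|/(dvdn_leq x0)]; lia.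
Qed.
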